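(* For each $X\in\{\ell_\infty,c,c_0\}$, the spaces $X(\Omega)$ and $X(\Gamma)$ are $BK$-spaces with the norms $\|x\|_{X(\Omega)}=\|\Omega x\|_{\ell_\infty}$ and $\|x\|_{X(\Gamma)}=\|\Gamma x\|_{\ell_\infty}$, respectively.
   Context: $\omega$ is the space of all real (or complex) sequences $x=(x_k)_{k\ge1}$; $\ell_\infty$, $c$, $c_0$ are the spaces of bounded, convergent and null sequences, and $\|x\|_{\ell_\infty}=\sup_k|x_k|$. The infinite matrix $\Omega=(a_{nk})_{n,k\ge1}$ is defined by $a_{nk}=k$ for $1\le k\le n$ and $a_{nk}=0$ for $k>n$; the infinite matrix $\Gamma=(b_{nk})_{n,k\ge1}$ is defined by $b_{nk}=1/k$ for $1\le k\le n$ and $b_{nk}=0$ for $k>n$. Thus $(\Omega x)_n=\sum_{k=1}^n kx_k$ and $(\Gamma x)_n=\sum_{k=1}^n k^{-1}x_k$. For $X\in\{\ell_\infty,c,c_0\}$, $X(\Omega)=\{x\in\omega:\Omega x\in X\}$ and $X(\Gamma)=\{x\in\omega:\Gamma x\in X\}$. A $K$-space is a linear subspace of $\omega$ with a linear topology for which every coordinate map $x\mapsto x_i$ is continuous; an $FK$-space is a $K$-space that is a complete linear metric space; a $BK$-space is an $FK$-space whose topology is normable (i.e. a Banach sequence space with continuous coordinates). *)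

(* Defs.v *)
From HB Require Import structures.
From mathcomp Require Import all_boot all_order all_algebra.
From mathcomp Require Import complex.
From mathcomp Require Import all_classical all_reals all_analysis.

Set Implicit Arguments.
Unset Strict Implicit.
Unset Printing Implicit Defensive.

Import Order.TTheory GRing.Theory Num.Theory.
Import numFieldNormedType.Exports.

Local Open Scope classical_set_scope.
Local Open Scope ring_scope.

(* Sequences and matrices are indexed from 0: index k stands for the
   mathematical index k + 1. *)

Definition l_infty (K : numFieldType) : set (nat -> K) :=
  [set x | bounded_fun x].

Definition c_space (K : numFieldType) : set (nat -> K) :=
  [set x | cvgn x].

Definition c0_space (K : numFieldType) : set (nat -> K) :=
  [set x | x @ \oo --> (0 : K)].

(* The norm of a numFieldType K is K-valued, so the supremum is taken for the
   order of K.  When K = R[i], z <= w holds iff Im z = Im w and Re z <= Re w,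
   hence the supremum of a nonempty bounded set of real numbers is the usual
   one.  The value is junk if x is unbounded. *)
Definition linfty_norm (K : numFieldType) (x : nat -> K) : K :=
  supremum 0 (range (fun k => `|x k|)).

(* (A x)_n = \sum_k a_nk x_k, meaningful when these series converge, e.g. when
   A is triangular. *)
Definition mx_transform (K : numFieldType) (A : nat -> nat -> K)
    (x : nat -> K) : nat -> K :=
  fun n => limn (series (fun k => A n k * x k)).

Definition mx_domain (K : numFieldType) (A : nat -> nat -> K)
    (X : set (nat -> K)) : set (nat -> K) :=
  [set x | X (mx_transform A x)].

Definition Omega (K : numFieldType) : nat -> nat -> K :=
  fun n k => if (k <= n)%N then k.+1%:R else 0.

Definition Gamma (K : numFieldType) : nat -> nat -> K :=
  fun n k => if (k <= n)%N then k.+1%:R^-1 else 0.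

(* The set X of sequences, with N as norm, is a BK-space: identified with a
   Banach space V through a linear isometric bijection f from V onto X, it has
   continuous coordinates.  That X is a linear subspace of the space of all
   sequences and that N is a norm on X are part of the existence of f. *)
Definition is_BK_space (K : numFieldType) (X : set (nat -> K))
    (N : (nat -> K) -> K) : Prop :=
  exists (V : completeNormedModType K) (f : {linear V -> (nat -> K)}),
    [/\ injective f,
        range f = X,
        forall v : V, `|v| = N (f v)
      & forall i : nat, continuous (fun v : V => f v i)].

Lemma mx_transform_triangle (K : numFieldType) (A : nat -> nat -> K)
    (x : nat -> K) (n : nat) :
  (forall k, (n < k)%N -> A n k = 0) ->
  mx_transform A x n = \sum_(k < n.+1) A n k * x k.
Proof.
move=> A0; apply: cvg_lim; first exact: norm_hausdorff.
apply: cvg_near_cst; exists n.+1 => // m /= nm.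
rewrite /series /= (big_cat_nat _ nm) //= big_mkord.
rewrite [X in _ + X]big_nat [X in _ + X]big1 ?addr0 // => k /andP[nk _].
by rewrite A0 // mul0r.
Qed.

Lemma OmegaE (K : numFieldType) (x : nat -> K) (n : nat) :
  mx_transform (@Omega K) x n = \sum_(k < n.+1) k.+1%:R * x k.
Proof.
rewrite mx_transform_triangle => [|k nk]; last by rewrite /Omega leqNgt nk.
by apply: eq_bigr => k _; rewrite /Omega -ltnS ltn_ord.
Qed.

Lemma GammaE (K : numFieldType) (x : nat -> K) (n : nat) :
  mx_transform (@Gamma K) x n = \sum_(k < n.+1) k.+1%:R^-1 * x k.
Proof.
rewrite mx_transform_triangle => [|k nk]; last by rewrite /Gamma leqNgt nk.
by apply: eq_bigr => k _; rewrite /Gamma -ltnS ltn_ord.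
Qed.

(* Main.v *)
(* On X(Omega) and X(Gamma) the matrix acts as T x = (\sum_(k <= n) w_k x_k)_n
   with nonzero weights w_k, hence T is a bijection of the space of all
   sequences, with inverse (T^-1 y)_n = (y_n - y_(n-1)) / w_n.  So T is a linear
   isometry of X(A) onto X with the sup norm, which is complete because X is
   closed under uniform limits, and the coordinates of T^-1 y are continuous
   because they only involve two coordinates of y.
   The field only enters through its Cauchy completeness and the existence of
   suprema of bounded sequences of norms, which are checked for R and R[i]. *)
Require Import Defs.
From HB Require Import structures.
From mathcomp Require Import all_boot all_order all_algebra.
From mathcomp Require Import complex.
From mathcomp Require Import all_classical all_reals all_analysis.

Set Implicit Arguments.
Unset Strict Implicit.
Unset Printing Implicit Defensive.

Import Order.TTheory GRing.Theory Num.Theory.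
Import numFieldNormedType.Exports.

Local Open Scope classical_set_scope.
Local Open Scope ring_scope.

(** * Suprema and sup-normed sequence spaces *)

Lemma supremum_supremums d (T : porderType d) (x0 : T) (A : set T) :
  A !=set0 -> supremums A !=set0 -> supremums A (supremum x0 A).
Proof.
(* On a nonempty set [supremum] is a choice among the least upper bounds, and [s] witnesses that
   there is one to choose. *)
move=> /set0P A0 [s As]; rewrite /supremum (negbTE A0).
by case: xgetP => [//|/(_ s)].
Qed.

Definition has_norm_sups (K : numFieldType) : Prop :=
  forall x : nat -> K, l_infty x -> supremums (range (fun k => `|x k|)) !=set0.

Definition cauchy_complete (K : numFieldType) : Prop :=
  forall F : set_system K, ProperFilter F -> cauchy F -> cvg F.

(** Closeness is stated coordinatewise because [linfty_norm (x - y)] has no meaning before the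
    difference is known to be bounded. *)
Definition unif_closed (K : numFieldType) (S : {pred nat -> K}) : Prop :=
  forall x : nat -> K,
    (forall e, 0 < e -> exists2 y, y \in S & forall k, `|x k - y k| <= e) ->
  x \in S.

(** Bundling lets the sup-norm structure be built once for all three spaces; the last field makes
    [linfty_norm] a genuine least upper bound on the space. *)
Record normable_seqs (K : numFieldType) := NormableSeqs {
  seqs_pred :> {pred nat -> K};
  seqs_submod : submod_closed seqs_pred;
  seqs_norm_sup : forall x, x \in seqs_pred ->
    supremums (range (fun k => `|x k|)) !=set0 }.

Section seqs_pred.
Variables (K : numFieldType) (E : normable_seqs K).
HB.instance Definition _ :=
  GRing.isSubmodClosed.Build K (nat -> K) (seqs_pred E) (seqs_submod E).
End seqs_pred.

Record seqs (K : numFieldType) (E : normable_seqs K) :=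
  Seqs { seqs_val :> nat -> K; _ : seqs_val \in seqs_pred E }.

Section seqs_normed.
Variables (K : numFieldType) (E : normable_seqs K).
HB.instance Definition _ := [isSub of seqs E for @seqs_val K E].
HB.instance Definition _ := [Choice of seqs E by <:].
HB.instance Definition _ := [SubChoice_isSubLmodule of seqs E by <:].

Implicit Types v w : seqs E.

Lemma seqs_norm_ub v k : `|v k| <= linfty_norm v.
Proof.
have [+ _] := supremum_supremums 0
  (ex_intro _ `|v 0%N| (ex_intro2 _ _ 0%N I erefl)) (seqs_norm_sup (valP v)).
by apply; exists k.
Qed.

Lemma seqs_norm_le v M : (forall k, `|v k| <= M) -> linfty_norm v <= M.
Proof.
move=> vM; have [_ lub] := supremum_supremums 0
  (ex_intro _ `|v 0%N| (ex_intro2 _ _ 0%N I erefl)) (seqs_norm_sup (valP v)).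
by apply: lub => _ [k _ <-]; exact: vM.
Qed.

Lemma seqs_normD v w :
  linfty_norm (v + w : seqs E) <= linfty_norm v + linfty_norm w.
Proof.
apply: seqs_norm_le => k.
exact: le_trans (ler_normD _ _) (lerD (seqs_norm_ub v k) (seqs_norm_ub w k)).
Qed.

Lemma seqs_norm_ge0 v : 0 <= linfty_norm v.
Proof. exact: le_trans (seqs_norm_ub v 0%N). Qed.

(** The inequality [leZ] follows from the bounds on coordinates; for nonzero [a] its converse is
    [leZ] applied to [a^-1] and [a *: v]. *)
Lemma seqs_normZ (a : K) v :
  linfty_norm (a *: v : seqs E) = `|a| * linfty_norm v.
Proof.
have leZ b w : linfty_norm (b *: w : seqs E) <= `|b| * linfty_norm w.
  apply: seqs_norm_le => k; rewrite [X in `|X|]/(b * w k) normrM.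
  exact: ler_wpM2l (seqs_norm_ub w k).
have [->|a0] := eqVneq a 0.
  apply/le_anti; rewrite leZ normr0 mul0r; exact: seqs_norm_ge0.
apply/le_anti; rewrite leZ /= -ler_pdivlMl ?normr_gt0 // -normfV.
by rewrite -{1}[v](scalerK a0) leZ.
Qed.

Lemma seqs_norm_eq0 v : linfty_norm v = 0 -> v = 0.
Proof.
move=> v0; apply/val_inj/funext => k; apply/eqP.
by rewrite -normr_le0 -v0 seqs_norm_ub.
Qed.

HB.instance Definition _ := @Lmodule_isNormed.Build K (seqs E)
  (fun v => linfty_norm v) seqs_normD seqs_normZ seqs_norm_eq0.

Lemma seqs_val_continuous k : continuous (fun v : seqs E => v k).
Proof.
move=> v; apply/(@cvgrPdist_lt _ _ _ (nbhs v)) => e e0; near=> w.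
apply: le_lt_trans (seqs_norm_ub (v - w) k) _.
have : ball v e w by near: w; exact: nbhsx_ballx.
by rewrite -ball_normE.
Unshelve. all: by end_near. Qed.

(** Coordinates are 1-Lipschitz for the sup norm, so they converge along [F]. The Cauchy estimates
    survive in the coordinatewise limit uniformly in the index, which puts the limit in [E] and
    gives convergence in norm. *)
Lemma seqs_complete (Kc : cauchy_complete K) (Ec : unif_closed E) :
  forall F : set_system (seqs E), ProperFilter F -> cauchy F -> cvg F.
Proof.
move=> F FF /cauchyP Fc.
have /choice[l Fl] : forall k, exists l : K, v k @[v --> F] --> l.
  move=> k; apply/cvg_ex; apply: Kc; apply: cauchy_exP => e /Fc[v Fv].
  exists (v k).
  suff : F [set w : seqs E | ball (v k) e (w k)] by [].
  apply: filterS Fv => w; rewrite -!ball_normE /=.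
  exact: le_lt_trans (seqs_norm_ub (v - w) k).
(* The auxiliary [w] may depend on [k], but the resulting bound [e] does not. *)
have dist_le v e : F (ball v e) -> forall k, `|l k - v k| <= e.
  move=> Fv k; apply/ler_addgt0Pr => d d0; near F => w.
  rewrite (le_trans (ler_distD (w k) _ _)) // addrC lerD //.
    rewrite distrC; have : ball v e w by near: w.
    rewrite -ball_normE /= => /ltW; apply: le_trans.
    exact: (seqs_norm_ub (v - w)).
  by apply: ltW; near: w; move/cvgrPdist_lt: (Fl k); exact.
have lE : l \in seqs_pred E.
  apply: Ec => e /Fc[v /dist_le ve].
  by exists (v : nat -> K) => //; exact: (valP v).
apply/cvg_ex; exists (Seqs lE); apply/cvgrPdist_le => e e0.
have /Fc[v Fv] : 0 < e / 2 by rewrite divr_gt0.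
near=> w; apply: seqs_norm_le => k; rewrite [X in `|X|]/(l k - w k).
rewrite (le_trans (ler_distD (v k) _ _)) // (splitr e) lerD ?dist_le //.
have : ball v (e / 2) w by near: w.
rewrite -ball_normE /= => /ltW; apply: le_trans.
exact: (seqs_norm_ub (v - w)).
Unshelve. all: by end_near. Qed.

End seqs_normed.

(** * Weighted partial sums and the domains of their matrices *)

Definition wsum (K : numFieldType) (w x : nat -> K) : nat -> K :=
  fun n => \sum_(k < n.+1) w k * x k.

(** At index 0 the preceding partial sum is empty, hence the value 0. *)
Definition wdiff (K : numFieldType) (w y : nat -> K) : nat -> K :=
  fun n => (w n)^-1 * (y n - if n is m.+1 then y m else 0).

Section weighted_sums.
Variables (K : numFieldType) (w : nat -> K).
Hypothesis w0 : forall k, w k != 0.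

Lemma wsumK : cancel (wsum w) (wdiff w).
Proof.
move=> x; apply/funext => -[|n]; rewrite /wdiff /wsum.
  by rewrite big_ord1 subr0 mulKf.
by rewrite big_ord_recr /= [X in X - _]addrC addrK mulKf.
Qed.

Lemma wdiffK : cancel (wdiff w) (wsum w).
Proof.
move=> y; apply/funext => n; rewrite /wsum.
elim: n => [|n IHn].
  by rewrite big_ord1 /wdiff subr0 mulVKf.
by rewrite big_ord_recr IHn /= mulVKf // subrKC.
Qed.

Lemma wdiffP (a : K) (x y : nat -> K) n :
  wdiff w (a *: x + y) n = a * wdiff w x n + wdiff w y n.
Proof.
rewrite mulrCA -mulrDr; congr (_ * _).
case: n => [|n]; first by rewrite !subr0.
by rewrite mulrBr addrACA -opprD.
Qed.

End weighted_sums.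

(** The Banach space is [E] itself with the sup norm, mapped onto the domain of [A] by [wdiff w];
    the isometry is then the cancellation [wdiffK]. *)
Lemma is_BK_domain (K : numFieldType) (Kc : cauchy_complete K)
    (E : normable_seqs K) (Ec : unif_closed E)
    (A : nat -> nat -> K) (w : nat -> K) (w0 : forall k, w k != 0)
    (AE : forall x n, mx_transform A x n = \sum_(k < n.+1) w k * x k) :
  is_BK_space (mx_domain A [set x | x \in seqs_pred E])
    (fun x => linfty_norm (mx_transform A x)).
Proof.
have {}AE x : mx_transform A x = wsum w x by apply/funext => n; rewrite AE.
pose V : completeNormedModType K :=
  HB.pack (seqs E) (Uniform_isComplete.Build (seqs E) (seqs_complete Kc Ec)).
pose f (v : V) : nat -> K := wdiff w (seqs_val v).
have f_lin : linear f.
  by move=> a u v; apply/funext => n; exact: wdiffP.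
pose g : {linear V -> (nat -> K)} :=
  HB.pack f (GRing.isLinear.Build K V (nat -> K) *:%R f f_lin).
exists V, g.
split=> /=.
- by move=> u v /(can_inj (wdiffK w0)) uv; apply: val_inj.
- apply/seteqP; split=> [_ [v _ <-] /=|x].
    by rewrite /mx_domain /= AE wdiffK //; exact: valP.
  rewrite /mx_domain /= AE => Ex; exists (Seqs Ex) => //.
  exact: (wsumK w0).
- by move=> v; rewrite AE wdiffK.
- move=> n v /=; rewrite /f /wdiff.
  apply: (@cvgMl_tmp _ _ (nbhs v) _
    (fun u : V => u n - if n is m.+1 then seqs_val u m else 0)).
  apply: (@cvgB _ K _ (nbhs v) _ (fun u : V => seqs_val u n)
    (fun u : V => if n is m.+1 then seqs_val u m else 0)).
    exact: seqs_val_continuous.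
  by case: n => [|n]; [exact: cvg_cst | exact: seqs_val_continuous].
Qed.

(** * Bounded, convergent and null sequences *)

Lemma l_inftyP (K : numFieldType) (x : nat -> K) :
  l_infty x <-> exists M, forall k, `|x k| <= M.
Proof.
split=> [[M [Mr xM]]|[M xM]].
  (* [bounded_fun] only provides bounds strictly above [M]. *)
  by exists (M + 1) => k; apply: xM => //; rewrite ltrDl.
(* [M] is real because it dominates a norm, hence is nonnegative. *)
exists M; split=> [|N MN k _]; first exact: ger0_real (le_trans _ (xM 0%N)).
exact: le_trans (xM k) (ltW MN).
Qed.

Lemma sub_l_infty (K : numFieldType) (X : set (nat -> K)) :
  [\/ X = @l_infty K, X = @c_space K | X = @c0_space K] ->
  X `<=` @l_infty K.
Proof.
case=> -> // x /= cx; first exact: cvg_seq_bounded.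
by apply: cvg_seq_bounded; apply/cvg_ex; exists 0.
Qed.

Lemma submod_closed_seqs (K : numFieldType) (X : set (nat -> K)) :
  [\/ X = @l_infty K, X = @c_space K | X = @c0_space K] ->
  submod_closed [in X].
Proof.
case=> ->; split=> [|a x y]; rewrite !inE.
- by apply/l_inftyP; exists 0 => k; rewrite normr0.
- move=> /l_inftyP[M xM] /l_inftyP[N yN]; apply/l_inftyP.
  exists (`|a| * M + N) => k.
  by rewrite (le_trans (ler_normD _ _)) // lerD // normrM ler_wpM2l.
- exact: is_cvg_cst.
- by move=> cx cy; apply: is_cvgD => //; exact: is_cvgMl_tmp.
- exact: cvg_cst.
- move=> cx cy; rewrite /c0_space /= -[0](addr0 (0 : K)) -{1}(mulr0 a).
  by apply: cvgD => //; exact: cvgMl_tmp.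
Qed.

Lemma unif_closed_seqs (K : numFieldType) (X : set (nat -> K)) :
  cauchy_complete K ->
  [\/ X = @l_infty K, X = @c_space K | X = @c0_space K] ->
  unif_closed [in X].
Proof.
move=> Kc [] -> x xy; rewrite !inE.
- have [y] := xy 1 ltr01; rewrite !inE => /l_inftyP[M yM] xy1.
  apply/l_inftyP; exists (1 + M) => k.
  by rewrite -(subrK (y k) (x k)) (le_trans (ler_normD _ _)) // lerD.
(* The limit of an approximant at distance [e / 2] is the centre of a ball of radius [e] that
   eventually contains [x n]. *)
- apply: Kc; apply: cauchy_exP => e e0.
  have [y] := xy _ (divr_gt0 e0 (ltr0n _ 2)).
  rewrite !inE => /cvg_ex[l /cvgrPdist_lt/(_ _ (divr_gt0 e0 (ltr0n _ 2))) yl] xye.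
  exists l; suff : \forall n \near \oo, ball l e (x n) by [].
  near=> n; rewrite -ball_normE /= (splitr e).
  rewrite (le_lt_trans (ler_distD (y n) _ _)) // ltr_leD //; last by rewrite distrC.
  by near: n.
- apply/cvgrPdist_le => e e0.
  have [y] := xy _ (divr_gt0 e0 (ltr0n _ 2)).
  rewrite !inE => /cvgrPdist_le/(_ _ (divr_gt0 e0 (ltr0n _ 2))) y0 xye.
  near=> n; rewrite sub0r normrN -(subrK (y n) (x n)).
  rewrite (le_trans (ler_normD _ _)) // (splitr e) lerD //.
  by rewrite -normrN -sub0r; near: n.
Unshelve. all: by end_near. Qed.

(** * Real and complex scalars *)

Lemma real_cauchy_complete (R : realType) : cauchy_complete R.
Proof. exact: R_complete. Qed.

Lemma real_has_norm_sups (R : realType) : has_norm_sups R.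
Proof.
move=> x /l_inftyP[M xM]; exists (sup (range (fun k => `|x k|))).
have hs : has_sup (range (fun k => `|x k|)).
  by split; [exists `|x 0%N|, 0%N | exists M => _ [k _ <-]; exact: xM].
by split; [exact/ubP/sup_upper_bound | move=> y; exact: ge_sup hs.1].
Qed.

Lemma complex_norm_le (R : rcfType) (z : R[i]) :
  `|z| <= (`|complex.Re z| + `|complex.Im z|)%:C%C.
Proof.
rewrite normc_def lecR -[leRHS]ger0_norm ?addr_ge0 // -[leRHS]sqrtr_sqr.
apply: ler_wsqrtr; rewrite sqrrD !real_normK ?num_real // addrAC lerDl.
by rewrite mulrn_wge0 // mulr_ge0.
Qed.

(** Real and imaginary parts are 1-Lipschitz, so both converge by completeness of [R];
    [complex_norm_le] recombines the two limits. *)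
Lemma complex_cauchy_complete (R : realType) :
  cauchy_complete (R[i] : numFieldType).
Proof.
move=> F FF /cauchyP Fc.
have part_cvg (g : R[i] -> R) :
    (forall z z' : R[i], `|g z - g z'|%:C%C <= `|z - z'|) ->
    cvg (g z @[z --> F]).
  move=> g_le; apply: R_complete; apply: cauchy_exP => e e0.
  have /Fc[z Fz] : 0 < e%:C%C by rewrite ltcR.
  exists (g z).
  suff : F [set z' | ball (g z) e (g z')] by [].
  apply: filterS Fz => z'; rewrite -!ball_normE /= => zz'.
  by rewrite -ltcR; exact: le_lt_trans zz'.
have Re_le (z z' : R[i]) : `|complex.Re z - complex.Re z'|%:C%C <= `|z - z'|.
  case: z z' => [a b] [c d]; rewrite normc_def lecR /= -[leLHS]sqrtr_sqr.
  by apply: ler_wsqrtr; rewrite lerDl sqr_ge0.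
have Im_le (z z' : R[i]) : `|complex.Im z - complex.Im z'|%:C%C <= `|z - z'|.
  case: z z' => [a b] [c d]; rewrite normc_def lecR /= -[leLHS]sqrtr_sqr.
  by apply: ler_wsqrtr; rewrite lerDr sqr_ge0.
have /cvg_ex[a Fa] := part_cvg _ Re_le.
have /cvg_ex[b Fb] := part_cvg _ Im_le.
apply/cvg_ex; exists (Complex a b).
apply/cvgrPdist_lt => e e0.
(* A positive complex number is real, so [e] can be halved inside [R]. *)
have eE : e = (complex.Re e)%:C%C by rewrite RRe_real ?gtr0_real.
have Re_e : 0 < complex.Re e / 2 by rewrite divr_gt0 // -ltcR -eE.
move/cvgrPdist_lt: Fa => /(_ _ Re_e) Fa.
move/cvgrPdist_lt: Fb => /(_ _ Re_e) Fb.
near=> z; apply: le_lt_trans (complex_norm_le _) _.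
rewrite eE ltcR (splitr (complex.Re e)) !raddfB /=.
by apply: ltrD; near: z.
Unshelve. all: by end_near. Qed.

(** Norms are real, so the supremum of their real parts, taken in [R] and embedded, is the
    candidate. *)
Lemma complex_has_norm_sups (R : realType) :
  has_norm_sups (R[i] : numFieldType).
Proof.
move=> x /l_inftyP[M xM].
have xE k : `|x k| = (complex.Re `|x k|)%:C%C by rewrite RRe_real ?normr_real.
have [s [s_ub s_lub]] : supremums (range (fun k => complex.Re `|x k|)) !=set0.
  have hs : has_sup (range (fun k => complex.Re `|x k|)).
    split; [by exists (complex.Re `|x 0%N|), 0%N|].
    by exists (complex.Re M) => _ [k _ <-]; have := xM k; rewrite lecE => /andP[].
  exists (sup (range (fun k => complex.Re `|x k|))).
  by split; [exact/ubP/sup_upper_bound | move=> y; exact: ge_sup hs.1].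
exists s%:C%C; split=> [_ [k _ <-]|y y_ub].
  by rewrite xE lecR; apply: s_ub; exists k.
have xy k : `|x k| <= y by apply: y_ub; exists k.
rewrite lecE; apply/andP; split.
  (* Comparability with one norm already forces the imaginary part of [y] to vanish. *)
  by have := xy 0%N; rewrite xE lecE => /andP[].
by apply: s_lub => _ [k _ <-]; have := xy k; rewrite xE lecE => /andP[].
Qed.

Theorem theorem2p2 (R : realType) (K : numFieldType)
    (hK : K = (R : numFieldType) \/ K = (R[i] : numFieldType))
    (X : set (nat -> K))
    (hX : [\/ X = @l_infty K, X = @c_space K | X = @c0_space K]) :
  is_BK_space (mx_domain (@Omega K) X)
    (fun x => linfty_norm (mx_transform (@Omega K) x)) /\
  is_BK_space (mx_domain (@Gamma K) X)
    (fun x => linfty_norm (mx_transform (@Gamma K) x)).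
Proof.
have [Kc Ks] : cauchy_complete K /\ has_norm_sups K.
  case: hK => ->.
    by split; [exact: real_cauchy_complete | exact: real_has_norm_sups].
  by split; [exact: complex_cauchy_complete | exact: complex_has_norm_sups].
(* All three spaces consist of bounded sequences, so the suprema of norms exist on [X]. *)
pose E := NormableSeqs (submod_closed_seqs hX)
  (fun x Ex => Ks x (sub_l_infty hX (set_mem Ex))).
have XE : X = [set x | x \in seqs_pred E].
  by apply/seteqP; split=> x /=; rewrite inE.
have Ec := unif_closed_seqs Kc hX.
have w0 k : k.+1%:R != 0 :> K by rewrite pnatr_eq0.
rewrite XE; split.
  exact: (is_BK_domain Kc (E := E) Ec w0 (@OmegaE K)).
have w0V k : k.+1%:R^-1 != 0 :> K by rewrite invr_eq0.
exact: (is_BK_domain Kc (E := E) Ec w0V (@GammaE K)).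
Qed.
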